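(* Let $M(x)$ be the generating function of the Motzkin numbers and $F(x,6)=M(x)^6$. For every integer $n\ge 0$, \begin{align*} H_{6n}(F(x,6))&=H_{6n+1}(F(x,6))=(-1)^n(n+1)^5,\\ H_{6n+2}(F(x,6))&=(-1)^n\tfrac{1}{10}(4n+5)(2n+3)(4n-3)(n+2)(n+1)^4,\\ H_{6n+3}(F(x,6))&=(-1)^n\tfrac{1}{45}(144n^2+72n-155)(n+2)^2(2n+3)^2(n+1)^3,\\ H_{6n+4}(F(x,6))&=(-1)^{n+1}\tfrac{1}{45}(n+2)^3(2n+3)^2(144n^2+792n+925)(n+1)^2,\\ H_{6n+5}(F(x,6))&=(-1)^n\tfrac{1}{10}(4n+15)(4n+7)(n+2)^4(2n+3)(n+1). \end{align*}
   Context: The Motzkin numbers are $M_n=\sum_{k\ge 0}\binom{n}{2k}C_k$, where $C_k=\frac{1}{k+1}\binom{2k}{k}$ is the $k$-th Catalan number; equivalently $M(x)=\sum_{n\ge0}M_nx^n=\frac{1-x-\sqrt{1-2x-3x^2}}{2x^2}$. For a formal power series $A(x)=\sum_{n\ge 0}a_nx^n$, its Hankel determinants are $H_n(A(x))=\det(a_{i+j})_{0\le i,j\le n-1}$ for $n\ge1$, and $H_0(A(x))=1$. *)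

(* Defs.v *)
From mathcomp Require Import all_boot all_order all_algebra.

Set Implicit Arguments.
Unset Strict Implicit.
Unset Printing Implicit Defensive.

Import GRing.Theory.
Local Open Scope ring_scope.

(* A formal power series \sum_n a_n x^n is represented by its coefficient
   sequence n |-> a_n. *)
Definition fps (R : Type) := nat -> R.

Definition fps_one {R : comNzRingType} : fps R := fun n => (n == 0)%N%:R.

Definition fps_mul {R : comNzRingType} (A B : fps R) : fps R :=
  fun n => \sum_(i < n.+1) A i * B (n - i)%N.

Definition fps_exp {R : comNzRingType} (A : fps R) (r : nat) : fps R :=
  iter r (fps_mul A) fps_one.

Definition hankel_mx {R : comNzRingType} (n : nat) (A : fps R) : 'M[R]_n :=
  \matrix_(i < n, j < n) A (i + j)%N.

Definition hankel {R : comNzRingType} (n : nat) (A : fps R) : R :=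
  \det (hankel_mx n A).

Lemma hankel0 (R : comNzRingType) (A : fps R) : hankel 0 A = 1.
Proof. exact: det_mx00. Qed.

Definition catalan (k : nat) : rat := 'C(2 * k, k)%:R / k.+1%:R.

(* The terms with k > n vanish, since then 2k > n. *)
Definition motzkin (n : nat) : rat :=
  \sum_(k < n.+1) 'C(n, 2 * k)%:R * catalan k.

Definition motzkin_gf : fps rat := motzkin.

(* F(x, r) = M(x)^r *)
Definition motzkin_pow (r : nat) : fps rat := fps_exp motzkin_gf r.

(* Main.v *)
(* Let T i n count the Motzkin paths from height 0 to height i in n steps. Then
   [x^j] M^(i+1) = T i (i + j), so the sequence of F = M^6 is T 5 (5 + j), and
   the rows T i are orthogonal polynomials in disguise: T i n = 0 for n < i,
   T i i = 1, and shifting n gives T (i+1) + T i + T (i-1). The monic polynomial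
   P_k of degree k orthogonal for F is therefore determined by a combination
   sum_(m <= 10) b_m T (k + m) that equals b_10 times the sequence
   j |-> L_F(P_k X^j), where L_F(X^j) is the j-th coefficient of F; consequently
   H_(k+1) / H_k = b_0 / b_10. For k = 6n + r the b_m are explicit polynomials in
   n, and the three-term recurrence of the P_k turns into polynomial identities
   between the coefficients for k, k + 1 and k + 2. *)
Require Import Defs.
From mathcomp Require Import all_boot all_order all_algebra.
From mathcomp Require Import ring lra.

Import Order.TTheory GRing.Theory Num.Theory.

Local Open Scope ring_scope.

(** * Ballot numbers, the Motzkin triangle and powers of M *)

(** Nonnegative paths with k + i up and k down steps, by the reflection principle: the paths that
    touch -1 are reflected to end at -2 - i, hence have k + i + 1 down steps. *)
Definition ballot (k i : nat) : rat :=
  'C(2 * k + i, k)%:R - 'C(2 * k + i, k + i.+1)%:R.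

Lemma ballot0 i : ballot 0 i = 1.
Proof. by rewrite /ballot muln0 !add0n bin0 bin_small // subr0. Qed.

Lemma ballotSS k i : ballot k.+1 i.+1 = ballot k.+1 i + ballot k i.+2.
Proof.
by rewrite /ballot !mulnS !addSn !addnS !add0n !binS !natrD; ring.
Qed.

Lemma ballotS0 k : ballot k.+1 0 = ballot k 1.
Proof. by rewrite /ballot !mulnS !addSn !addnS !addn0 !add0n !binS !natrD; ring. Qed.

Lemma catalanE k : catalan k = ballot k 0.
Proof.
rewrite /catalan /ballot addn0 addn1.
have k1 : k.+1%:R != 0 :> rat by rewrite pnatr_eq0.
apply: (mulIf k1); rewrite divfK // mulrBl -[X in _ - X]natrM.
rewrite [('C(_, k.+1) * _)%N]mulnC mul_bin_left mul2n -addnn addnK natrM.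
by rewrite -natr1; ring.
Qed.

(* The number of Motzkin paths from height 0 to height i in n steps, chosen by
   the positions of the 2k + i steps that are not horizontal. *)
Definition motzkin_triangle (i n : nat) : rat :=
  \sum_(k < n.+1) 'C(n, 2 * k + i)%:R * ballot k i.

Local Notation T := motzkin_triangle.

Lemma motzkin_triangle_widen N i n : (n < N)%N ->
  T i n = \sum_(k < N) 'C(n, 2 * k + i)%:R * ballot k i.
Proof.
move=> nN; rewrite /T (big_ord_widen N (fun k => 'C(n, 2 * k + i)%:R * ballot k i)) //.
rewrite big_mkcond; apply: eq_bigr => k _; case: ltnP => // nk.
by rewrite bin_small ?mul0r // mul2n -addnn -addnA (leq_trans nk) // leq_addr.
Qed.

Lemma motzkin_triangle0 n : T 0 n = motzkin n.
Proof. by apply: eq_bigr => k _; rewrite addn0 catalanE. Qed.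

Lemma motzkin_triangle_small i n : (n < i)%N -> T i n = 0.
Proof.
by move=> ni; apply: big1 => k _; rewrite bin_small ?mul0r // (leq_trans ni) ?leq_addl.
Qed.

Lemma motzkin_triangle_diag n : T n n = 1.
Proof.
rewrite /T big_ord_recl ballot0 muln0 add0n binn mulr1 big1 ?addr0 // => k _.
by rewrite bin_small ?mul0r // lift0 -[ltnLHS]add0n ltn_add2r.
Qed.

Lemma motzkin_triangle0S n : T 0 n.+1 = T 1 n + T 0 n.
Proof.
rewrite (motzkin_triangle_widen n.+3) // (@motzkin_triangle_widen n.+3 0 n) 1?leqW //.
rewrite (@motzkin_triangle_widen n.+2 1 n) 1?leqW //.
rewrite !(big_ord_recl n.+2) !muln0 !bin0 !ballot0 addrCA; congr (_ + _).
rewrite -big_split; apply: eq_bigr => k _ /=.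
rewrite /bump add1n mulnS !addSn !addn0 addn1 add0n binS natrD ballotS0.
ring.
Qed.

(** Pascal's rule separates a horizontal last step from the others; [ballotSS] then separates up
    from down, and the down terms move from k + 1 to k. *)
Lemma motzkin_triangleSS i n : T i.+1 n.+1 = T i.+2 n + T i.+1 n + T i n.
Proof.
rewrite (motzkin_triangle_widen n.+3) // (@motzkin_triangle_widen n.+2 i.+2 n) 1?leqW //.
rewrite !(@motzkin_triangle_widen n.+3 _ n) 1?leqW //.
have pascal k : 'C(n.+1, 2 * k + i.+1)%:R * ballot k i.+1 =
    'C(n, 2 * k + i.+1)%:R * ballot k i.+1 + 'C(n, 2 * k + i)%:R * ballot k i.+1.
  by rewrite addnS binS natrD mulrDl.
under eq_bigr do rewrite pascal.
rewrite big_split /= addrAC [RHS]addrC; congr (_ + _).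
rewrite !(big_ord_recl n.+2) !ballot0 addrCA; congr (_ + _).
rewrite -big_split; apply: eq_bigr => k _ /=.
by rewrite /bump add1n ballotSS mulnS !addSn add0n !addnS; ring.
Qed.

Lemma motzkin_triangleS0 i : T i 0 = (i == 0)%N%:R.
Proof.
by case: i => [|i]; [exact: motzkin_triangle_diag | exact: motzkin_triangle_small].
Qed.

(* The generating functions [G_i] of the rows satisfy [G_(i+1) = x G_0 G_i]:
   with [D_i := x G_0 G_i - G_(i+1)], the recurrences of the triangle give
   [D_i = x (D_(i+1) + D_i + D_(i-1))], which forces [D_i = 0]. *)
Lemma motzkin_triangle_conv i n :
  fps_mul (T 0) (T i) n = T i.+1 n.+1.
Proof.
have mul0 f : fps_mul (T 0) f 0 = f 0.
  by rewrite /fps_mul big_ord1 motzkin_triangleS0 mul1r.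
have mulS f m : fps_mul (T 0) f m.+1 =
    T 0 m.+1 * f 0 + fps_mul (T 0) (fun j => f j.+1) m.
  rewrite /fps_mul big_ord_recr subnn addrC; congr (_ + _).
  by apply: eq_bigr => a _ /=; rewrite subSn // -ltnS.
have mulD f g m : fps_mul (T 0) (fun j => f j + g j) m =
    fps_mul (T 0) f m + fps_mul (T 0) g m.
  by rewrite /fps_mul -big_split; apply: eq_bigr => a _ /=; rewrite mulrDr.
have eq_mul f g m : f =1 g -> fps_mul (T 0) f m = fps_mul (T 0) g m.
  by move=> fg; apply: eq_bigr => a _; rewrite fg.
elim: n i => [|n IHn] [|i].
- by rewrite mul0 !motzkin_triangle_diag.
- by rewrite mul0 motzkin_triangleS0 motzkin_triangle_small.
- rewrite mulS (eq_mul _ _ _ motzkin_triangle0S) mulD !IHn.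
  by rewrite motzkin_triangleS0 (motzkin_triangleSS 0 n.+1) /= mulr1 addrC.
- rewrite mulS (eq_mul _ _ _ (motzkin_triangleSS i)) !mulD !IHn.
  by rewrite motzkin_triangleS0 mulr0 add0r -motzkin_triangleSS.
Qed.

(** By [motzkin_triangle_conv], row r has generating function x^r M^(r+1); the offset r removes
    x^r. *)
Lemma motzkin_powE r j : motzkin_pow r.+1 j = T r (r + j).
Proof.
elim: r j => [|r IHr] j.
  rewrite /motzkin_pow /= /fps_mul big_ord_recr /= subnn /fps_one mulr1.
  rewrite big1 ?add0r ?motzkin_triangle0 // => i _.
  by rewrite subn_eq0 leqNgt ltn_ord mulr0.
have -> : motzkin_pow r.+2 j = fps_mul motzkin_gf (motzkin_pow r.+1) j by [].
rewrite addSn -motzkin_triangle_conv /fps_mul.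
(* The convolution for the triangle has r more terms; they vanish because T r (r + j - i) = 0 for i
   > j. *)
rewrite (big_ord_widen (r + j).+1
  (fun i => motzkin_gf i * motzkin_pow r.+1 (j - i)%N)) ?ltnS ?leq_addl //.
rewrite big_mkcond; apply: eq_bigr => i _.
rewrite motzkin_triangle0; case: ltnP => ij.
  by rewrite IHr addnBA // -ltnS.
rewrite motzkin_triangle_small ?mulr0 // ltn_subLR; last by rewrite -ltnS.
by rewrite [ltnRHS]addnC ltn_add2l.
Qed.

(** * Moment functionals and Hankel determinants *)

(** This is L_A(p X^j) for the linear functional with L_A(X^l) = [A l]. *)
Definition moment {R : comNzRingType} (A : fps R) (p : {poly R}) (j : nat) : R :=
  \sum_(l < size p) p`_l * A (l + j)%N.

Lemma moment_widen (R : comNzRingType) (A : fps R) (p : {poly R}) N j :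
  (size p <= N)%N -> moment A p j = \sum_(l < N) p`_l * A (l + j)%N.
Proof.
move=> pN; rewrite /moment (big_ord_widen N (fun l => p`_l * A (l + j)%N)) //.
rewrite big_mkcond; apply: eq_bigr => l _; case: ltnP => // /(nth_default 0) ->.
by rewrite mul0r.
Qed.

Lemma momentD (R : comNzRingType) (A : fps R) (p q : {poly R}) j :
  moment A (p + q) j = moment A p j + moment A q j.
Proof.
rewrite !(@moment_widen _ _ _ (maxn (size p) (size q))) ?leq_maxl ?leq_maxr ?size_polyD //.
by rewrite -big_split; apply: eq_bigr => l _; rewrite coefD mulrDl.
Qed.

Lemma momentZ (R : comNzRingType) (A : fps R) c (p : {poly R}) j :
  moment A (c *: p) j = c * moment A p j.
Proof.
rewrite !(@moment_widen _ _ _ (size p)) ?size_scale_leq // mulr_sumr.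
by apply: eq_bigr => l _; rewrite coefZ mulrA.
Qed.

Lemma momentX (R : comNzRingType) (A : fps R) (p : {poly R}) j :
  moment A ('X * p) j = moment A p j.+1.
Proof.
rewrite (mulrC 'X) (@moment_widen _ _ _ (size p).+1); last first.
  by rewrite (leq_trans (size_polyMleq _ _)) // size_polyX addn2.
rewrite big_ord_recl coefMX mul0r add0r; apply: eq_bigr => l _.
by rewrite coefMX /= /bump add1n addnS.
Qed.

Lemma moment1 (R : comNzRingType) (A : fps R) j : moment A 1 j = A j.
Proof. by rewrite /moment size_poly1 big_ord1 coef1 mul1r. Qed.

(** The coefficient matrix of the P_k is lower unitriangular. Its product with the Hankel matrix has
    entries L_A(P_k X^j), so it is upper triangular with diagonal h. *)
Lemma hankel_orthogonal (R : comNzRingType) (A : fps R) (h : nat -> R) n :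
    (forall k, (k < n)%N -> exists P : {poly R},
       [/\ P \is monic, size P = k.+1
         & forall j, (j <= k)%N -> moment A P j = h k *+ (j == k)]) ->
  hankel n A = \prod_(k < n) h k.
Proof.
move=> orthoP.
have /fin_all_exists[P /all_and3[Pmonic Psize Pmoment]] (k : 'I_n) := orthoP k (ltn_ord k).
pose C : 'M[R]_n := \matrix_(k, l) (P k)`_l.
have Ctrig : is_trig_mx C.
  by apply/is_trig_mxP => k l kl; rewrite mxE nth_default // Psize.
have detC : \det C = 1.
  rewrite det_trig // big1 // => k _; rewrite mxE.
  by have := monicP (Pmonic k); rewrite lead_coefE Psize.
have CA k j : (C *m hankel_mx n A) k j = moment A (P k) j.
  rewrite (@moment_widen _ _ _ n) ?Psize // mxE.
  by apply: eq_bigr => l _; rewrite !mxE.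
rewrite /hankel -[LHS]mul1r -[X in X * _]detC -det_mulmx -det_tr det_trig.
  by apply: eq_bigr => k _; rewrite mxE CA Pmoment // eqxx.
by apply/is_trig_mxP => k l kl; rewrite mxE CA Pmoment ?(ltnW kl) // ltn_eqF.
Qed.

(** * Orthogonal polynomials for the sixth power *)

(** Each shift raises the top row by one with coefficient 1, so for monic P the row [T (k + 10)] has
    coefficient 1; the factor b_10 allows [b] to be given up to a scalar. *)
Definition ortho_poly (k : nat) (b : seq rat) (P : {poly rat}) : Prop :=
  [/\ P \is monic, size P = k.+1
    & forall j, b`_10 * moment (motzkin_pow 6) P j = \sum_(m < 11) b`_m * T (k + m) j].

Lemma ortho_poly_moment k b P j : b`_10 != 0 -> ortho_poly k b P -> (j <= k)%N ->
  moment (motzkin_pow 6) P j = (b`_0 / b`_10) *+ (j == k).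
Proof.
move=> b10 [_ _ PE] jk; apply: (mulfI b10); rewrite PE big_ord_recl addn0.
rewrite big1 ?addr0 => [|m _].
  case: (eqVneq j k) => [->|neq_jk].
    by rewrite motzkin_triangle_diag mulr1 mulr1n mulrC divfK.
  by rewrite motzkin_triangle_small ?mulr0 // ltn_neqAle neq_jk.
by rewrite motzkin_triangle_small ?mulr0 // addnS ltnS (leq_trans jk) ?leq_addr.
Qed.

(* [P'' = (X + c) P' - t P], with c and t chosen to cancel the coefficients of
   [T k] and [T k.+1]. *)
Lemma ortho_poly_recurrence k (b b' b'' : seq rat) P P' :
    size b = 11 -> size b' = 11 ->
    b`_0 != 0 -> b`_10 != 0 -> b'`_0 != 0 -> b'`_10 != 0 ->
    (forall m, (m < 11)%N -> b'`_10 * b'`_0 * b`_0 * b''`_m =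
       b''`_10 * (b`_0 * b'`_0 * (b'`_m + b'`_m.+2)
                  + (b`_1 * b'`_0 - b'`_1 * b`_0) * b'`_m.+1
                  - b'`_0 ^+ 2 * b`_m.+2)) ->
    ortho_poly k b P -> ortho_poly k.+1 b' P' ->
  exists P'', ortho_poly k.+2 b'' P''.
Proof.
move=> sb sb' b0 b10 b'0 b'10 bE [Pmon Psz PE] [P'mon P'sz P'E].
pose c := b`_1 / b`_0 - b'`_1 / b'`_0 - 1.
pose t := (b'`_0 / b'`_10) * (b`_10 / b`_0).
pose Q := c *: P' + - t *: P.
have Qsz : (size Q < size ('X * P')%R)%N.
  rewrite mulrC size_mulX ?monic_neq0 // P'sz ltnS (leq_trans (size_polyD _ _)) //.
  by rewrite geq_max !(leq_trans (size_scale_leq _ _)) ?P'sz ?Psz.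
exists ('X * P' + Q); split.
- by rewrite monicE lead_coefDl // -monicE monicMl ?monicX.
- by rewrite size_polyDl // mulrC size_mulX ?monic_neq0 // P'sz.
move=> j; rewrite !momentD momentX !momentZ.
have D0 : b'`_10 * b'`_0 * b`_0 != 0 by rewrite !mulf_neq0.
apply: (mulfI D0); rewrite [RHS]mulr_sumr.
under [RHS]eq_bigr => m _ do rewrite mulrA bE //.
transitivity (b''`_10 * (b'`_0 * b`_0 * (b'`_10 * moment (motzkin_pow 6) P' j.+1)
   + (b`_1 * b'`_0 - b'`_1 * b`_0 - b`_0 * b'`_0) * (b'`_10 * moment (motzkin_pow 6) P' j)
   - b'`_0 ^+ 2 * (b`_10 * moment (motzkin_pow 6) P j))).
  by rewrite /c /t; field; rewrite b0 b'0 b'10.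
rewrite P'E P'E PE.
rewrite !big_ord_recl !big_ord0 /= /bump /= !addSn !addnS !addn0.
rewrite !motzkin_triangleSS.
(* For m = 9 and m = 10 the indices run past the lists, where the default 0 is the right
   coefficient. *)
rewrite [b'`_11]nth_default ?sb' // [b'`_12]nth_default ?sb' //.
rewrite [b`_11]nth_default ?sb // [b`_12]nth_default ?sb //.
ring.
Qed.

(* The coefficients b_m for k = 6x + r, up to a scalar, obtained by running the
   three-term recurrence and interpolating in x. The symmetry T (-2 - i) = - T i
   of the recurrence of the rows exchanges k with -12 - k, hence r with 6 - r and
   x with - x - 3, and reverses the list. *)
Definition ortho_coefs1 {R : realFieldType} (x : R) : seq R :=
  let p := 3 * (x + 2) * (2 * x + 3) * (4 * x - 3) * (4 * x + 5) in
  let q := 8 * (x + 2) * (2 * x + 3) * (24 * x ^+ 2 + 12 * x - 25) in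
  let s := (x + 2) * (1824 * x ^+ 3 + 3648 * x ^+ 2 - 262 * x - 2475) in
  [:: p; q; 10 * p; 16 * p; s; 16 * p; 10 * p; q; p; 0; 30 * (x + 1)].

Definition ortho_coefs2 {R : realFieldType} (x : R) : seq R :=
  let p := 2 * (x + 2) * (2 * x + 3) * (144 * x ^+ 2 + 72 * x - 155) in
  let q := 54 * (x + 2) * (2 * x + 3) * (4 * x - 3) * (4 * x + 5) in
  let s := 9 * (x + 2) * (4 * x - 3) * (4 * x + 5) * (24 * x + 35) in
  let t := (x + 2) * (4032 * x ^+ 3 + 7920 * x ^+ 2 - 668 * x - 5355) in
  let u := 9 * (x + 1) * (4 * x - 3) * (4 * x + 5) in
  let v := 3 * (x + 1) * (48 * x ^+ 2 + 24 * x - 25) in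
  [:: p; q; s; t; s; q; p; 0; u; v; u].

Definition ortho_coefs3 {R : realFieldType} (x : R) : seq R :=
  let p := - (x + 2) * (144 * x ^+ 2 + 792 * x + 925) in
  let q := - 2 * (x + 2) * (144 * x ^+ 2 + 792 * x + 895) in
  let s := - 3 * (x + 2) * (144 * x ^+ 2 + 792 * x + 845) in
  let t := (x + 1) * (144 * x ^+ 2 + 72 * x - 155) in
  let u := 2 * (x + 1) * (144 * x ^+ 2 + 72 * x - 185) in
  let v := 3 * (x + 1) * (144 * x ^+ 2 + 72 * x - 235) in
  [:: p; q; s; q; p; 0; t; u; v; u; t].

Definition ortho_coefs {R : realFieldType} (r : nat) (x : R) : seq R :=
  match r with
  | 0 => [:: 1; 5; 15; 30; 45; 51; 45; 30; 15; 5; 1]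
  | 1 => ortho_coefs1 x
  | 2 => ortho_coefs2 x
  | 3 => ortho_coefs3 x
  | 4 => rev (ortho_coefs2 (- x - 3))
  | _ => rev (ortho_coefs1 (- x - 3))
  end.

(** * Nonvanishing and recurrence of the coefficients *)

(** Parity replaces a sign argument for 4x - 3 and 144x^2 + 72x - 155, which are negative at x = 0
    and positive later. *)
Lemma natr_double_odd_neq0 (R : numDomainType) (a b : nat) :
  odd b -> a.*2%:R - b%:R != 0 :> R.
Proof. by apply: contraTneq => /eqP; rewrite subr_eq0 eqr_nat => /eqP<-; rewrite odd_double. Qed.

Lemma ortho_factors_neq0 (R : realFieldType) (n : nat) (x : R := n%:R) :
  [/\ x + 1 != 0, x + 2 != 0, 2 * x + 3 != 0, 4 * x - 3 != 0
    & 4 * x + 5 != 0] /\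
  [/\ 4 * x + 7 != 0, 4 * x + 15 != 0, 144 * x ^+ 2 + 72 * x - 155 != 0
    & 144 * x ^+ 2 + 792 * x + 925 != 0].
Proof.
have x0 : 0 <= x by exact: ler0n.
have xx0 : 0 <= x ^+ 2 by exact: sqr_ge0.
split; split; try by apply: lt0r_neq0; lra.
  have -> : 4 * x - 3 = (2 * n).*2%:R - 3%:R by rewrite -mul2n !natrM; ring.
  exact: natr_double_odd_neq0.
have -> : 144 * x ^+ 2 + 72 * x - 155 = (72 * n ^ 2 + 36 * n).*2%:R - 155%:R.
  by rewrite -mul2n natrM natrD !natrM; ring.
exact: natr_double_odd_neq0.
Qed.

Lemma ortho_coefs_neq0 (R : realFieldType) n r : (r < 6)%N ->
  (ortho_coefs r n%:R)`_0 != 0 :> R /\ (ortho_coefs r n%:R)`_10 != 0 :> R.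
Proof.
have := ortho_factors_neq0 R n.
move: n%:R => x [[x1 x2 x3 x4 x5] [x6 x7 x8 x9]].
(* The reflection of x to - x - 3 sends each factor to another one up to sign, which settles r = 4
   and r = 5. *)
have e1 : - x - 3 + 1 = - (x + 2) :> R by ring.
have e2 : - x - 3 + 2 = - (x + 1) :> R by ring.
have e3 : 2 * (- x - 3) + 3 = - (2 * x + 3) :> R by ring.
have e4 : 4 * (- x - 3) - 3 = - (4 * x + 15) :> R by ring.
have e5 : 4 * (- x - 3) + 5 = - (4 * x + 7) :> R by ring.
have e6 : 144 * (- x - 3) ^+ 2 + 72 * (- x - 3) - 155 =
    144 * x ^+ 2 + 792 * x + 925 :> R by ring.
move: r => [|[|[|[|[|[|//]]]]]] _; rewrite /= ?e1 ?e2 ?e3 ?e4 ?e5 ?e6;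
  by split; rewrite ?mulf_neq0 ?oppr_eq0 ?oner_eq0 ?pnatr_eq0.
Qed.

(** A polynomial identity in x for each pair r, m; [c] carries the window r, r + 1, r + 2 over into
    the next block. *)
Lemma ortho_coefs_recurrence (R : realFieldType) (x : R) r m
    (c := fun r => if (r < 6)%N then ortho_coefs r x else ortho_coefs (r - 6) (x + 1))
    (b := c r) (b' := c r.+1) (b'' := c r.+2) :
    (r < 6)%N -> (m < 11)%N ->
  b'`_10 * b'`_0 * b`_0 * b''`_m =
    b''`_10 * (b`_0 * b'`_0 * (b'`_m + b'`_m.+2)
               + (b`_1 * b'`_0 - b'`_1 * b`_0) * b'`_m.+1
               - b'`_0 ^+ 2 * b`_m.+2).
Proof.
rewrite /b /b' /b'' /c {c b b' b''}.
move: r => [|[|[|[|[|[|//]]]]]] _;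
  move: m => [|[|[|[|[|[|[|[|[|[|[|//]]]]]]]]]]] _; rewrite /= /rev /=; ring.
Qed.

Definition ortho_coefs_at (k : nat) : seq rat := ortho_coefs (k %% 6) (k %/ 6)%:R.

Lemma ortho_coefs_atE n r : (r < 12)%N -> ortho_coefs_at (6 * n + r) =
  if (r < 6)%N then ortho_coefs r n%:R else ortho_coefs (r - 6) (n%:R + 1).
Proof.
rewrite /ortho_coefs_at mulnC => r12; case: ltnP => [r6|/subnK rE].
  by rewrite divnMDl // modnMDl divn_small // modn_small // addn0.
have s6 : (r - 6 < 6)%N by rewrite ltn_subLR // -[r]rE leq_addl.
rewrite -{1 2}rE addnCA addnC -mulSnr divnMDl // modnMDl divn_small // modn_small // addn0.
by rewrite -natr1.
Qed.

Lemma ortho_coefs_at_neq0 k : (ortho_coefs_at k)`_0 != 0 /\ (ortho_coefs_at k)`_10 != 0.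
Proof. by apply: ortho_coefs_neq0; rewrite ltn_mod. Qed.

Lemma size_ortho_coefs_at k : size (ortho_coefs_at k) = 11.
Proof.
by rewrite /ortho_coefs_at; case: (k %% 6)%N => [|[|[|[|[|?]]]]]; rewrite //= size_rev.
Qed.

Lemma ortho_poly_exists k : exists P, ortho_poly k (ortho_coefs_at k) P.
Proof.
suff: (exists P, ortho_poly k (ortho_coefs_at k) P) /\
      (exists P, ortho_poly k.+1 (ortho_coefs_at k.+1) P) by case.
elim: k => [|k [[P PP] [P' P'P]]]; split.
- exists 1; split; rewrite ?monic1 ?size_poly1 // => j.
  (* Unfolding five steps of T 5 (5 + j) gives the coefficients of (1 + t + t^2)^5, the list for r =
     0: height 0 is reached only at the last step, so nothing is cut off. *)
  rewrite moment1 motzkin_powE mul1r !big_ord_recl big_ord0 /=.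
  rewrite !addSn !add0n !(motzkin_triangleSS, motzkin_triangle0S) /bump /= !addn0 !add1n; ring.
(* The constant 6 is the coefficient of x in M^6, so this polynomial is orthogonal to 1. *)
- exists ('X - 6%:P); split; rewrite ?monicXsubC ?size_XsubC // => j.
  have -> : 'X - 6%:P = 'X * 1 + (- 6) *: 1 :> {poly rat}.
    by rewrite mulr1 scaleNr alg_polyC.
  rewrite momentD momentX momentZ !moment1 !motzkin_powE.
  rewrite -[ortho_coefs_at 1]/(ortho_coefs1 0) !big_ord_recl big_ord0 /bump /=.
  rewrite !addSn !add0n !(motzkin_triangleSS, motzkin_triangle0S).
  ring.
- by exists P'.
have [b0 b10] := ortho_coefs_at_neq0 k; have [b'0 b'10] := ortho_coefs_at_neq0 k.+1.
apply: (ortho_poly_recurrence _ _ _ _ _ _ _ _ b0 b10 b'0 b'10 _ PP P'P);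
  rewrite ?size_ortho_coefs_at // => m m11.
have r6 : (k %% 6 < 6)%N by rewrite ltn_mod.
have atE s : (s < 6)%N -> ortho_coefs_at (s + k) =
    if (s + k %% 6 < 6)%N then ortho_coefs (s + k %% 6) (k %/ 6)%:R
    else ortho_coefs (s + k %% 6 - 6) ((k %/ 6)%:R + 1).
  move=> s6; rewrite [in LHS](divn_eq k 6) addnCA mulnC ortho_coefs_atE //.
  exact: leq_add s6 (ltnW r6).
rewrite (atE 2 isT : _ k.+2 = _) (atE 1%N isT : _ k.+1 = _) (atE 0%N isT : _ k = _).
exact: ortho_coefs_recurrence.
Qed.

(** * Evaluation of the determinants, block by block *)

Lemma hankel_motzkin_pow6_prod n :
  hankel n (motzkin_pow 6) =
    \prod_(k < n) ((ortho_coefs_at k)`_0 / (ortho_coefs_at k)`_10).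
Proof.
apply: (hankel_orthogonal _ _ (fun k => (ortho_coefs_at k)`_0 / (ortho_coefs_at k)`_10)) => k _.
have [P PP] := ortho_poly_exists k; have [_ b10] := ortho_coefs_at_neq0 k.
by exists P; have [Pmonic Psize _] := PP; split=> // j; apply: ortho_poly_moment.
Qed.

Lemma hankel_motzkin_pow6S n r : (r < 6)%N ->
  hankel (6 * n + r).+1 (motzkin_pow 6) =
    hankel (6 * n + r) (motzkin_pow 6) * ((ortho_coefs r n%:R)`_0 / (ortho_coefs r n%:R)`_10).
Proof.
by move=> r6; rewrite !hankel_motzkin_pow6_prod big_ord_recr ortho_coefs_atE ?r6 // (leq_trans r6).
Qed.

(* The determinant of order 6n + r for e = (-1)^n and x = n; r = 6 is the first
   entry of the next block. *)
Definition hankel_value {R : realFieldType} (e x : R) (r : nat) : R :=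
  match r with
  | 0 | 1 => e * (x + 1) ^+ 5
  | 2 => e * (1 / 10)
         * (4 * x + 5) * (2 * x + 3) * (4 * x - 3) * (x + 2) * (x + 1) ^+ 4
  | 3 => e * (1 / 45)
         * (144 * x ^+ 2 + 72 * x - 155)
         * (x + 2) ^+ 2 * (2 * x + 3) ^+ 2 * (x + 1) ^+ 3
  | 4 => - e * (1 / 45)
         * (x + 2) ^+ 3 * (2 * x + 3) ^+ 2
         * (144 * x ^+ 2 + 792 * x + 925) * (x + 1) ^+ 2
  | 5 => e * (1 / 10)
         * (4 * x + 15) * (4 * x + 7) * (x + 2) ^+ 4 * (2 * x + 3) * (x + 1)
  | _ => - e * (x + 1 + 1) ^+ 5
  end.

Lemma hankel_valueS (R : realFieldType) (e : R) n r : (r < 6)%N ->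
  hankel_value e n%:R r * ((ortho_coefs r n%:R)`_0 / (ortho_coefs r n%:R)`_10) =
  hankel_value e n%:R r.+1.
Proof.
move=> r6; have [_] := ortho_coefs_neq0 R n r r6.
move: n%:R => x; move: r r6 => [|[|[|[|[|[|//]]]]]] _; rewrite /= /rev /= => nz.
- by rewrite divr1 mulr1.
all: apply/(mulIf nz); rewrite -[LHS]mulrA divfK //; field; rewrite ?pnatr_eq0 //.
Qed.

Lemma hankel_motzkin_pow6 n r : (r <= 6)%N ->
  hankel (6 * n + r) (motzkin_pow 6) = hankel_value ((-1) ^+ n) n%:R r.
Proof.
have block m :
    hankel (6 * m) (motzkin_pow 6) = hankel_value ((-1) ^+ m) m%:R 0 ->
    forall s, (s <= 6)%N ->
    hankel (6 * m + s) (motzkin_pow 6) = hankel_value ((-1) ^+ m) m%:R s.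
  move=> H0; elim=> [|s IHs] s6; first by rewrite addn0.
  by rewrite addnS hankel_motzkin_pow6S // IHs ?(ltnW s6) // hankel_valueS.
apply: (block); elim: n => [|n IHn].
  by rewrite muln0 hankel0 /= add0r !expr1n mulr1.
(* Entry 6 of block n is entry 0 of block n + 1, with the sign flipped and x increased by 1. *)
by rewrite mulnSr (block n IHn 6 isT) /= [(-1) ^+ n.+1]exprS mulN1r -natr1.
Qed.

Theorem theorem2 (n : nat) :
  let F := motzkin_pow 6 in
  let x : rat := n%:R in
  [/\ hankel (6 * n) F = (-1) ^+ n * (x + 1) ^+ 5
        /\ hankel (6 * n + 1) F = (-1) ^+ n * (x + 1) ^+ 5,
      hankel (6 * n + 2) F =
        (-1) ^+ n * (1 / 10)
        * (4 * x + 5) * (2 * x + 3) * (4 * x - 3) * (x + 2) * (x + 1) ^+ 4,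
      hankel (6 * n + 3) F =
        (-1) ^+ n * (1 / 45)
        * (144 * x ^+ 2 + 72 * x - 155)
        * (x + 2) ^+ 2 * (2 * x + 3) ^+ 2 * (x + 1) ^+ 3,
      hankel (6 * n + 4) F =
        (-1) ^+ (n + 1) * (1 / 45)
        * (x + 2) ^+ 3 * (2 * x + 3) ^+ 2
        * (144 * x ^+ 2 + 792 * x + 925) * (x + 1) ^+ 2
    & hankel (6 * n + 5) F =
        (-1) ^+ n * (1 / 10)
        * (4 * x + 15) * (4 * x + 7) * (x + 2) ^+ 4 * (2 * x + 3) * (x + 1)].
Proof.
have H := hankel_motzkin_pow6 n; rewrite /= [(-1) ^+ (n + 1)]exprD expr1 mulrN1.
split; first split.
- by have := H 0%N isT; rewrite addn0.
- exact: H 1%N isT.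
- exact: H 2 isT.
- exact: H 3 isT.
- exact: H 4 isT.
- exact: H 5 isT.
Qed.
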